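(* Let $G$ and $H$ be DAGs on the same vertex set $[m]=\{1,\ldots,m\}$. Then $\mathbb{M}_+(G)=\mathbb{M}_+(H)$ if and only if $H$ can be obtained from $G$ by a (possibly empty) sequence of flips of trivially covered arrows.
   Context: For a DAG $G$ on $[m]$, $\mathbb{M}_+(G)$ is the set of Gaussian distributions, with positive definite covariance matrix, of vectors $X=(X_1,\ldots,X_m)$ admitting a representation $X_i=\sum_{j\in \mathrm{Pa}(i)}\Lambda_{ij}X_j+\varepsilon_i$ for all $i=1,\ldots,m$, where $\mathrm{Pa}(i)$ is the set of parents of $i$ in $G$, all $\Lambda_{ij}\ge 0$, and $\varepsilon_i\sim N(0,\sigma_i^2)$ are mutually independent. An arrow $i\to j$ in a DAG is trivially covered if $\mathrm{Pa}(i)\cup\{i\}=\mathrm{Pa}(j)=\{i\}$ (that is, $i$ has no parents and $i$ is the only parent of $j$). Flipping an arrow $i\to j$ means replacing it by $j\to i$. In a sequence of flips, each flipped arrow must be trivially covered in the DAG current at that stage. *)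

(* Defs.v *)
From HB Require Import structures.
From mathcomp Require Import all_boot all_order all_algebra.
From mathcomp Require Import all_classical all_reals all_analysis.

Set Implicit Arguments.
Unset Strict Implicit.
Unset Printing Implicit Defensive.

Import Order.TTheory GRing.Theory Num.Theory.

(* The vertex set {1, ..., m} is 'I_m; (i, j) \in G is the arrow i -> j. *)
Notation digraph m := {set 'I_m * 'I_m}.

Section Dags.
Variable m : nat.
Implicit Types (G H : digraph m) (i j : 'I_m).

Definition arrow G : rel 'I_m := fun i j => (i, j) \in G.

Definition is_dag G := forall c : seq 'I_m, c != [::] -> ~~ cycle (arrow G) c.

Definition Pa G j : {set 'I_m} := [set i | arrow G i j]%SET.

Definition trivially_covered G i j :=
  [&& arrow G i j, (Pa G i :|: [set i])%SET == Pa G j & Pa G j == [set i]%SET].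

Definition flip G i j : digraph m := ((j, i) |: G :\ (i, j))%SET.

Definition flip_step : rel (digraph m) := fun G H =>
  [exists i, exists j, trivially_covered G i j && (H == flip G i j)].

(* connect is the reflexive transitive closure, here of flip_step. *)
Definition flip_reachable G H : bool := connect flip_step G H.

End Dags.

Local Open Scope classical_set_scope.
Local Open Scope ring_scope.

(* N(a, s ^+ 2). The case s = 0 is separate because the library's normal_prob
   is a uniform law there. *)
Definition gauss {R : realType} (a s : R) : set R -> \bar R :=
  if s == 0 then \d_a else normal_prob a s.

Definition mutually_independent d (T : measurableType d) (R : realType)
    (P : probability T R) n (X : 'I_n -> {RV P >-> R}) :=
  forall (J : {set 'I_n}) (A : 'I_n -> set R),
    (forall i, measurable (A i)) ->
    P (\bigcap_(i in [set` J]) (X i @^-1` A i)) =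
    (\prod_(i in J) P (X i @^-1` A i))%E.

(* R^m is m.-tuple R, with the product sigma-algebra. *)
Section Laws.
Context {R : realType} {m : nat}.
Implicit Type mu : probability (m.-tuple R) R.

Definition gaussian_law mu := forall a : 'I_m -> R,
  exists b s : R, forall A : set R, measurable A ->
    mu ((fun x => \sum_i a i * tnth x i) @^-1` A) = gauss b s A.

Definition covmx mu : 'M[R]_m :=
  \matrix_(i, j) fine (covariance mu (fun x => tnth x i) (fun x => tnth x j)).

Definition posdefmx (S : 'M[R]_m) :=
  S^T = S /\ forall v : 'cV[R]_m, v != 0 -> 0 < (v^T *m S *m v) 0 0.

End Laws.

(* M_+(G). Laws are compared on measurable sets only: the values of a
   probability elsewhere are irrelevant. *)
Definition Mplus (R : realType) (m : nat) (G : digraph m) :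
    set (probability (m.-tuple R) R) :=
  [set mu | [/\ gaussian_law mu, posdefmx (covmx mu) &
    exists (d : measure_display) (T : measurableType d) (P : probability T R)
           (X : {RV P >-> m.-tuple R}) (eps : 'I_m -> {RV P >-> R})
           (Lambda : 'M[R]_m) (sigma : 'I_m -> R),
    [/\ forall A, measurable A -> mu A = distribution P X A,
        forall i j, j \in Pa G i -> 0 <= Lambda i j,
        forall i w, tnth (X w) i =
          \sum_(j in Pa G i) Lambda i j * tnth (X w) j + eps i w,
        forall i A, measurable A ->
          distribution P (eps i) A = gauss 0 (sigma i) A &
        mutually_independent eps]]].
Arguments Mplus R {m} G _.

(* Main.v *)
From HB Require Import structures.
Require Import Defs.
From mathcomp Require Import all_boot all_order all_algebra.
From mathcomp Require Import all_classical all_reals all_analysis.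
From mathcomp Require Import measurable_realfun ring lra.

(** Two observations carry the proof: a flip only changes which noise
    variables represent one and the same random vector, and the order of the
    vertices leaves a trace in the signs of the covariances.

    Flips preserve the model.  If [i -> j] is trivially covered, then
    X_i = e_i and X_j = l e_i + e_j.  Let c be the coefficient of the regression
    of X_i on X_j; it is nonnegative because l is.  With X_i - c X_j and X_j
    as noises at i and j, the same vector X is represented along the flipped
    graph, provided that the new noises are again independent normal variables,
    jointly independent of the others.  The
    map from the old pair to the new one is a product of two shears, so it
    preserves Lebesgue measure on the plane, and completing the square factors
    the transported density ([normal_prob_shear], [law_reverse],
    [Mplus_flip_sub]).

    Equal models come from flips, because of second moments alone.  In a
    representation along H the noise at a vertex l is uncorrelated with the
    coordinates of all vertices other than l that do not come after l in a
    topological order, so the covariances of X_l with these are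
    nonnegative combinations of those of its parents ([Mplus_regression]).
    This is tested on star models of G, in which a single vertex j is the sum of
    its noise and of the noises of chosen parents, all other coordinates being
    independent noises ([star_model]).  With one chosen parent, correlation
    forces adjacent vertices of G to be adjacent in H ([Mplus_adjacent]).  With
    two chosen parents i and k, the coordinate X_i is uncorrelated with X_k and yet
    positively correlated with X_j; a nonnegative combination without
    cancellation cannot achieve this, so neither i nor k comes after j in H, and
    an arrow [i -> j] of G that H reverses is the only arrow of G into j
    ([Mplus_reversed_parent]).  Exchanging G and H, it is also the only arrow
    of H into i.  Take a reversed arrow [i -> j] whose source is earliest in G:
    an arrow of G into i is then kept by H, hence starts at j, which a DAG
    excludes.  So [i -> j] is trivially covered, and flipping it keeps the model
    and lowers the number of arrows of G outside H ([flip_reachable_Mplus]). *)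

Set Implicit Arguments.
Unset Strict Implicit.
Unset Printing Implicit Defensive.

Import Order.TTheory GRing.Theory Num.Theory numFieldNormedType.Exports.
Local Open Scope classical_set_scope.
Local Open Scope ring_scope.

(** * Lebesgue measure and affine maps *)

Definition mfun_of d d' (T : measurableType d) (T' : measurableType d')
  (f : T -> T') (mf : measurable_fun setT f) : {mfun T >-> T'} :=
  HB.pack f (isMeasurableFun.Build _ _ _ _ f mf).

Section Lebesgue.
Context {R : realType}.
Notation leb := (@lebesgue_measure R).
Implicit Types a b x y s t : R.

Lemma measurable_affine a b : measurable_fun [set: R] (fun x => a * x + b).
Proof. by apply: measurable_funD => //; exact: measurable_funM. Qed.

Lemma affine_itv_oc a b x y : a != 0 ->
  (`|a|%:E * leb ((fun z => a * z + b)%R @^-1` `]x, y]) = leb `]x, y])%E.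
Proof.
move=> a0.
have [ag0|al0|/eqP] := ltgtP 0 a; last by rewrite eq_sym (negbTE a0).
- have -> : (fun z => a * z + b) @^-1` `]x, y] =
     `](x - b) / a, (y - b) / a]%classic.
    apply/seteqP; split => z /=; rewrite !in_itv /=;
      by rewrite ltr_pdivrMr// ler_pdivlMr// ltrBlDr lerBrDr (mulrC z).
  rewrite !lebesgue_measure_itv /= !lte_fin ltr_pM2r ?invr_gt0// ltrD2r.
  case: ifP => _; last by rewrite mule0.
  rewrite gtr0_norm// -!EFinD -EFinM; congr (_%:E); field.
  by rewrite a0.
- have -> : (fun z => a * z + b) @^-1` `]x, y] =
     `[(y - b) / a, (x - b) / a[%classic.
    apply/seteqP; split => z /=; rewrite !in_itv /= andbC;
      by rewrite ltr_ndivlMr// ler_ndivrMr// ltrBlDr lerBrDr (mulrC z).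
  rewrite !lebesgue_measure_itv /= !lte_fin ltr_nM2r ?invr_lt0// ltrD2r.
  case: ifP => _; last by rewrite mule0.
  rewrite ltr0_norm// -!EFinD -EFinM; congr (_%:E); field.
  by rewrite a0.
Qed.

(** Lebesgue measure is determined by its values on half-open intervals, where
    the rescaled image measure is computed in [affine_itv_oc]. *)
Lemma lebesgue_measure_affine a b (A : set R) : a != 0 -> measurable A ->
  (`|a|%:E * leb ((fun z => a * z + b)%R @^-1` A) = leb A)%E.
Proof.
move=> a0 mA; apply/esym.
pose phi : {mfun measurableTypeR R >-> measurableTypeR R} :=
  @mfun_of _ _ (measurableTypeR R) (measurableTypeR R) _ (measurable_affine a b).
have h := @lebesgue_measure_unique R
  (mscale (NngNum (normr_ge0 a)) (pushforward leb phi)).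
apply: h mA => _ [[x y] _ <-].
exact/esym/affine_itv_oc.
Qed.

Lemma ge0_integral_affine a b (f : R -> \bar R) : a != 0 ->
    measurable_fun setT f -> (forall x, (0 <= f x)%E) ->
  (\int[leb]_x f x = `|a|%:E * \int[leb]_x f (a * x + b)%R)%E.
Proof.
move=> a0 mf f0.
pose phi : {mfun measurableTypeR R >-> measurableTypeR R} :=
  @mfun_of _ _ (measurableTypeR R) (measurableTypeR R) _ (measurable_affine a b).
rewrite (eq_measure_integral
  (mscale (NngNum (normr_ge0 a)) (pushforward leb phi))); last first.
  by move=> A mA _; exact/esym/(lebesgue_measure_affine b a0 mA).
rewrite ge0_integral_mscale//= ge0_integral_pushforward//.
exact: measurable_affine.
Qed.

Lemma ge0_integral_shift b (f : R -> \bar R) :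
    measurable_fun setT f -> (forall x, (0 <= f x)%E) ->
  (\int[leb]_x f (x + b)%R = \int[leb]_x f x)%E.
Proof.
move=> mf f0; rewrite [RHS](ge0_integral_affine b (oner_neq0 R) mf f0).
by rewrite normr1 mul1e; under [RHS]eq_integral do rewrite mul1r.
Qed.

(** The explicit density is a Radon-Nikodym derivative of the normal law, by
    almost-everywhere uniqueness. *)
Lemma ge0_integral_normal_prob m s (f : R -> \bar R) :
    measurable_fun setT f -> (forall x, (0 <= f x)%E) ->
  (\int[normal_prob m s]_x f x = \int[leb]_x (f x * (normal_pdf m s x)%:E))%E.
Proof.
move=> mf f0; have dom := normal_prob_dominates m s.
rewrite -(Radon_Nikodym_SigmaFinite.change_of_variables dom)//.
have intf := Radon_Nikodym_SigmaFinite.f_integrable dom.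
apply: ae_eq_integral => //.
- by apply: emeasurable_funM => //; exact: measurable_int intf.
- apply: emeasurable_funM => //; apply/measurable_EFinP.
  exact: measurable_normal_pdf.
- apply: ae_eqe_mul2l; apply: integral_ae_eq => //.
    by apply/measurable_EFinP; exact: measurable_normal_pdf.
  by move=> E _ mE; rewrite -Radon_Nikodym_SigmaFinite.f_integral.
Qed.

End Lebesgue.

(** * Normal densities under shears and scalings *)

Section NormalCalculus.
Context {R : realType}.
Notation leb := (@lebesgue_measure R).
Notation MR := (measurableTypeR R).
Implicit Types a b l s t q u v x y : R.

(** Completing the square: with q the standard deviation of V + l U and c the
    regression coefficient of U on it, the joint density of independent normal
    U, V splits in the coordinates U - c (V + l U) and V + l U. *)
Lemma normal_pdf_factor l s t q u v (c := l * s ^+ 2 / q ^+ 2) :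
    s != 0 -> t != 0 -> q != 0 -> q ^+ 2 = l ^+ 2 * s ^+ 2 + t ^+ 2 ->
  normal_pdf 0 s (u + c * v) * normal_pdf 0 t (v - l * (u + c * v)) =
  normal_pdf 0 (s * t / q) u * normal_pdf 0 q v.
Proof.
move=> s0 t0 q0 qE.
have st0 : s * t / q != 0 by rewrite !mulf_neq0// invr_eq0.
rewrite !normal_pdfE// mulrACA [RHS]mulrACA; congr (_ * _).
  rewrite /normal_peak -!invfM -!sqrtrM; last 2 first.
  - by rewrite mulrn_wge0// mulr_ge0// ?sqr_ge0// pi_ge0.
  - by rewrite mulrn_wge0// mulr_ge0// ?sqr_ge0// pi_ge0.
  by congr ((Num.sqrt _)^-1); field.
rewrite /normal_fun -!expRD; congr expR; rewrite !subr0 /c.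
have -> : (s * t / q) ^+ 2 = s ^+ 2 * t ^+ 2 / q ^+ 2 by field.
have q20 : l ^+ 2 * s ^+ 2 + t ^+ 2 != 0 by rewrite -qE expf_neq0.
rewrite qE; field.
by rewrite s0 t0 exprMn q20.
Qed.

Lemma normal_prob_prodE s t (B : set (MR * MR)) : measurable B ->
  ((normal_prob 0 s \x normal_prob 0 t) B =
   \int[leb]_x \int[leb]_y
     ((\1_B (x, y))%:E * (normal_pdf 0 s x * normal_pdf 0 t y)%:E))%E.
Proof.
move=> mB; rewrite [LHS](ge0_integral_normal_prob 0 s); last 2 first.
- exact: measurable_fun_xsection.
- by move=> x.
apply: eq_integral => x _ /=.
rewrite /normal_prob integral_mkcond -ge0_integralZr//; last 3 first.
- apply/(measurable_restrictT _ _).1; first exact: measurable_xsection.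
  apply/measurable_funTS/measurable_EFinP; exact: measurable_normal_pdf.
- by move=> y _; apply: erestrict_ge0 => z _; rewrite lee_fin normal_pdf_ge0.
- by rewrite lee_fin normal_pdf_ge0.
apply: eq_integral => y _; rewrite patchE indicE mem_xsection.
by case: ifP => _; rewrite ?mul1e ?mul0e // EFinM muleC.
Qed.

(** The map from the noises (e_i, e_j) of X_i = e_i, X_j = e_j + l e_i to
    (X_i - c X_j, X_j); it is a composition of two elementary shears, one in
    each coordinate. *)
Definition shear l c (p : MR * MR) : MR * MR :=
  (p.1 - c * (p.2 + l * p.1), p.2 + l * p.1).

Lemma measurable_shear l c : measurable_fun setT (shear l c).
Proof.
have m2 : measurable_fun setT (fun p : MR * MR => p.2 + l * p.1).
  apply: (measurable_funD (f := snd)); first exact: measurable_snd.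
  by apply: measurable_funM => //; exact: measurable_fst.
apply: measurable_fun_pair => //.
apply: (measurable_funB (f := fst)); first exact: measurable_fst.
exact: measurable_funM.
Qed.

(** Each shear translates one coordinate while the other is fixed, so Fubini and
    the translation invariance of Lebesgue measure transport the product
    density, which factors again by [normal_pdf_factor]. *)
Lemma normal_prob_shear l s t q (B : set (MR * MR)) (c := l * s ^+ 2 / q ^+ 2) :
    s != 0 -> t != 0 -> q != 0 -> q ^+ 2 = l ^+ 2 * s ^+ 2 + t ^+ 2 ->
    measurable B ->
  ((normal_prob 0 s \x normal_prob 0 t) (shear l c @^-1` B) =
   (normal_prob 0 (s * t / q) \x normal_prob 0 q) B)%E.
Proof.
move=> s0 t0 q0 qE mB.
have m1 : measurable_fun setT (fst : MR * MR -> MR) by exact: measurable_fst.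
have m2 : measurable_fun setT (snd : MR * MR -> MR) by exact: measurable_snd.
have mpdf r (f : MR * MR -> MR) : measurable_fun setT f ->
    measurable_fun setT (fun p => normal_pdf 0 r (f p)).
  by move=> mf; apply: measurableT_comp => //; exact: measurable_normal_pdf.
have mM k (f g : MR * MR -> MR) : measurable_fun setT f ->
    measurable_fun setT g -> measurable_fun setT (fun p => f p - k * g p).
  by move=> mf mg; apply: measurable_funB => //; exact: measurable_funM.
have mS := measurable_funPTI (mfun_of (measurable_shear l c)) mB.
pose F (p : MR * MR) := ((\1_B (p.1 - c * p.2, p.2))%:E *
    (normal_pdf 0 s p.1 * normal_pdf 0 t (p.2 - l * p.1))%:E)%E.
have mF : measurable_fun setT F.
  apply: emeasurable_funM; apply/measurable_EFinP; last first.
    by apply: measurable_funM; apply: mpdf => //; exact: mM.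
  apply: (@measurableT_comp _ _ _ _ _ _ (\1_B : MR * MR -> R)).
    exact: measurable_indic.
  by apply: measurable_fun_pair => //; exact: mM.
pose G (p : MR * MR) := ((\1_B p)%:E *
    (normal_pdf 0 (s * t / q) p.1 * normal_pdf 0 q p.2)%:E)%E.
have mG : measurable_fun setT G.
  apply: emeasurable_funM; apply/measurable_EFinP.
    exact: measurable_indic.
  by apply: measurable_funM; exact: mpdf.
have F0 p : (0 <= F p)%E.
  by rewrite mule_ge0// lee_fin ?indic_ge0// mulr_ge0// normal_pdf_ge0.
have G0 p : (0 <= G p)%E.
  by rewrite mule_ge0// lee_fin ?indic_ge0// mulr_ge0// normal_pdf_ge0.
rewrite normal_prob_prodE//.
transitivity (\int[leb]_x \int[leb]_v F (x, v))%E.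
  (* inner shear: v = y + l * x at fixed x *)
  apply: eq_integral => x _.
  rewrite -[RHS](ge0_integral_shift (l * x)); last 2 first.
  - exact: measurable_fun_pair2 mF.
  - by move=> y; exact: F0.
  by apply: eq_integral => y _; rewrite /F /= addrK.
rewrite (fubini_tonelli F)//.
transitivity (\int[leb]_v \int[leb]_u G (u, v))%E.
  (* outer shear: u = x - c * v at fixed v *)
  apply: eq_integral => v _.
  rewrite -[LHS](ge0_integral_shift (c * v)); last 2 first.
  - exact: measurable_fun_pair1 mF.
  - by move=> y; exact: F0.
  apply: eq_integral => u _; rewrite /F /G /= addrK.
  by rewrite normal_pdf_factor.
rewrite -(fubini_tonelli G mG G0).
exact/esym/normal_prob_prodE.
Qed.

Lemma normal_prob_scale a s (A : set MR) : a != 0 -> s != 0 -> measurable A ->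
  normal_prob 0 s ((fun x => a * x) @^-1` A) = normal_prob 0 (a * s) A.
Proof.
move=> a0 s0 mA.
have as0 : a * s != 0 by rewrite mulf_neq0.
rewrite /normal_prob integral_mkcond [RHS]integral_mkcond.
pose g := (fun x => (normal_pdf 0 (a * s) x)%:E) \_ A.
have mg : measurable_fun [set: MR] g.
  apply/(measurable_restrictT _ _).1 => //.
  by apply/measurable_funTS/measurable_EFinP; exact: measurable_normal_pdf.
have g0 x : (0 <= g x)%E.
  by apply: erestrict_ge0 => z _; rewrite lee_fin normal_pdf_ge0.
rewrite [RHS](ge0_integral_affine 0 a0 mg g0) -ge0_integralZl//; last first.
  exact: (measurableT_comp mg (measurable_affine a 0)).
apply: eq_integral => x _; rewrite /g addr0 !patchE -[x \in _]/(a * x \in A).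
case: ifP => _; rewrite ?mule0// -EFinM; congr (_%:E).
rewrite !normal_pdfE// mulrA; congr (_ * _).
  rewrite /normal_peak.
  have -> : (a * s) ^+ 2 * pi *+ 2 = a ^+ 2 * (s ^+ 2 * pi *+ 2) by ring.
  rewrite sqrtrM ?sqr_ge0//.
  by rewrite sqrtr_sqr invfM mulrA divff ?mul1r ?normr_eq0.
rewrite /normal_fun; congr expR; rewrite !subr0; field.
by rewrite s0 a0.
Qed.

End NormalCalculus.

(** * Second moments of centred Gaussian laws *)

Section GaussianMoments.
Context {R : realType}.
Notation leb := (@lebesgue_measure R).
Notation MR := (measurableTypeR R).
Implicit Types s y : R.

(** The factor y^2 is absorbed by a part of the Gaussian decay, at the price of
    doubling the standard deviation; this makes second moments finite without
    computing them. *)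
Lemma sqr_normal_pdf_le s : s != 0 ->
  exists2 K : R, 0 <= K &
    forall y, y ^+ 2 * normal_pdf 0 s y <= K * normal_pdf 0 (2 * s) y.
Proof.
move=> s0; have s20 : 2 * s != 0 by rewrite mulf_neq0// pnatr_eq0.
exists (normal_peak s * (8 / 3 * s ^+ 2) / normal_peak (2 * s)) => [|y].
  by rewrite divr_ge0 ?normal_peak_ge0// mulr_ge0 ?normal_peak_ge0// mulr_ge0 ?sqr_ge0.
rewrite !normal_pdfE// [leRHS]mulrA divfK ?gt_eqF ?normal_peak_gt0//.
(* 3 / 8 = 1 / 2 - 1 / 8 compares the exponents of the two densities *)
pose z := 3 / 8 * y ^+ 2 / s ^+ 2.
have -> : normal_fun 0 s y = normal_fun 0 (2 * s) y * expR (- z).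
  by rewrite /normal_fun -expRD; congr expR; rewrite /z subr0; field.
have -> : y ^+ 2 = 8 / 3 * s ^+ 2 * z by rewrite /z; field.
have zE : z * expR (- z) <= 1.
  rewrite expRN ler_pdivrMr ?expR_gt0// mul1r.
  by apply: le_trans (expR_ge1Dx z); rewrite lerDr.
set p := normal_peak s; set n := normal_fun _ _ _.
have -> : 8 / 3 * s ^+ 2 * z * (p * (n * expR (- z))) =
  p * (8 / 3 * s ^+ 2) * n * (z * expR (- z)) by ring.
rewrite ler_piMr// mulr_ge0 ?normal_fun_ge0// mulr_ge0 ?normal_peak_ge0//.
by rewrite mulr_ge0 ?sqr_ge0.
Qed.

Lemma normal_prob_second_moment s : s != 0 ->
  (\int[normal_prob 0 s]_y (y ^+ 2)%:E < +oo)%E.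
Proof.
move=> s0; have [K K0 leK] := sqr_normal_pdf_le s0.
rewrite ge0_integral_normal_prob; last 2 first.
- by apply/measurable_EFinP; exact: measurable_funX.
- by move=> y; rewrite lee_fin sqr_ge0.
apply: (@le_lt_trans _ _ (\int[leb]_y (K%:E * (normal_pdf 0 (2 * s) y)%:E))%E).
  apply: ge0_le_integral => //=.
  - by move=> y _; rewrite lee_fin mulr_ge0 ?sqr_ge0 ?normal_pdf_ge0.
  - apply/measurable_EFinP; apply: measurable_funM; first exact: measurable_funX.
    exact: measurable_normal_pdf.
  - apply/measurable_EFinP; apply: measurable_funM => //.
    exact: measurable_normal_pdf.
  - by move=> y _; rewrite lee_fin leK.
rewrite ge0_integralZl//=.
- by rewrite integral_normal_pdf mule1 ltry.
- by apply/measurable_EFinP; exact: measurable_normal_pdf.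
- by move=> y _; rewrite lee_fin normal_pdf_ge0.
Qed.

Context d (T : measurableType d) (P : probability T R).

Lemma Lfun2_square (X : T -> R) : measurable_fun setT X ->
  (\int[P]_w (X w ^+ 2)%:E < +oo)%E -> X \in Lfun P 2%:E.
Proof.
move=> mX X2; rewrite inE; apply/andP; split; rewrite inE //=.
rewrite /finite_norm; apply: (@lty_poweRy _ _ 2) => //.
rewrite poweR_Lnorm// (le_lt_trans _ X2)//.
rewrite le_eqVlt; apply/orP; left; apply/eqP; apply: eq_integral => w _ /=.
by rewrite powR_mulrn// real_normK// num_real.
Qed.

(** X follows N(0, s^2), the point mass at 0 being included as s = 0. *)
Definition law (X : T -> R) s :=
  forall A : set R, measurable A -> P (X @^-1` A) = gauss 0 s A.

Lemma law0_integral (X : T -> R) (g : R -> \bar R) :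
    measurable_fun setT X -> law X 0 -> measurable_fun setT g ->
    (forall y, 0 <= g y)%E ->
  (\int[P]_w g (X w) = g 0%R)%E.
Proof.
move=> mX lX mg g0.
have := ge0_integral_pushforward mX P measurableT mg (fun y _ => g0 y).
rewrite /= preimage_setT => <-.
rewrite (eq_measure_integral (@dirac _ _ (0 : R) R)) => [|A mA _].
  by rewrite integral_dirac// diracT mul1e.
by have := lX A mA; rewrite /gauss eqxx.
Qed.

Lemma law_Lfun2 (X : T -> R) s : measurable_fun setT X -> law X s ->
  X \in Lfun P 2%:E.
Proof.
move=> mX lX; apply: Lfun2_square => //.
have [s0|s0] := eqVneq s 0.
  rewrite s0 in lX.
  rewrite (law0_integral (g := fun y => (y ^+ 2)%:E))//.
  - by rewrite ltry.
  - by apply/measurable_EFinP; exact: measurable_funX.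
  - by move=> y; rewrite lee_fin sqr_ge0.
pose g (y : MR) := (y ^+ 2)%:E.
have mg : measurable_fun setT g.
  by apply/measurable_EFinP; exact: measurable_funX.
have g0 y : (0 <= g y)%E by rewrite lee_fin sqr_ge0.
pose mX' : measurable_fun setT (X : T -> MR) := mX.
have := ge0_integral_pushforward mX' P measurableT mg (fun y _ => g0 y).
rewrite /= preimage_setT => <-.
rewrite (eq_measure_integral (normal_prob 0 s)) => [|A mA _].
  exact: normal_prob_second_moment.
by have := lX A mA; rewrite /gauss (negbTE s0).
Qed.

Lemma law_set1 (X : T -> R) s c : s != 0 -> law X s -> P (X @^-1` [set c]) = 0%E.
Proof.
move=> s0 lX; rewrite (lX _ (measurable_set1 c)) /gauss (negbTE s0).
apply: ((null_content_dominatesP _ _).1 (normal_prob_dominates 0 s)).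
  exact: (measurable_set1 c).
exact: lebesgue_measure_set1.
Qed.

(** A variable of variance zero is almost surely constant, but a normal law has
    no atoms. *)
Lemma law_variance_gt0 (X : T -> R) s :
  measurable_fun setT X -> s != 0 -> law X s -> (0 < covariance P X X)%E.
Proof.
move=> mX s0 lX.
rewrite lt0e (variance_ge0 P X : (0 <= covariance P X X)%E) andbT.
apply/negP => /eqP; rewrite unlock; set m := fine _; rewrite unlock => V0.
have mXm : measurable_fun setT (fun w => (((X \- cst m) * (X \- cst m)) w)%:E).
  apply/measurable_EFinP; apply: measurable_funM; exact: measurable_funB.
have /(ae_eq_integral_abs P measurableT mXm).1 : (\int[P]_(w in setT)
    `|(((X \- cst m) * (X \- cst m)) w)%:E| = 0)%E.
  rewrite -[RHS]V0; apply: eq_integral => w _.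
  by rewrite gee0_abs// lee_fin; exact: sqr_ge0.
move=> Xm; have : P.-negligible (~` (X @^-1` [set m])).
  apply: negligibleS Xm => w /= Xwm /(_ I) [] /eqP.
  by rewrite mulf_eq0 orbb subr_eq0 => /eqP.
have mX1 : measurable (X @^-1` [set m]).
  exact: (measurable_funPTI (mfun_of mX) (measurable_set1 m)).
move=> neg; have /eqP : P (~` (X @^-1` [set m])) = 0%E.
  exact: measure_negligible (measurableC mX1) neg.
by rewrite probability_setC// (law_set1 _ s0 lX) sube0 onee_eq0.
Qed.

Lemma law0_variance (X : T -> R) :
  measurable_fun setT X -> law X 0 -> covariance P X X = 0%E.
Proof.
move=> mX lX; apply/eqP; rewrite eq_le.
rewrite [X in _ && X](variance_ge0 P X : (0 <= covariance P X X)%E) andbT.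
have EX2 : 'E_P[X ^+ 2]%E = 0%E.
  rewrite unlock (law0_integral (g := fun y => (y ^+ 2)%:E))//.
  - by rewrite expr0n.
  - by apply/measurable_EFinP; exact: measurable_funX.
  - by move=> y; rewrite lee_fin sqr_ge0.
have := varianceE (law_Lfun2 mX lX); rewrite /variance EX2 => ->.
by rewrite sub0e oppe_le0 sqre_ge0.
Qed.

End GaussianMoments.

(** * Joint laws and independence *)

Section Independence.
Context d (T : measurableType d) (R : realType) (P : probability T R).

(** Independence on rectangles determines the joint law on all Borel sets, also
    after intersecting with an event E.  The event allows a pair of
    noise variables to be transformed while the remaining ones stay fixed. *)
Lemma joint_law_on d1 d2 (T1 : measurableType d1) (T2 : measurableType d2)
    (m1 : probability T1 R) (m2 : probability T2 R) (f : T -> T1 * T2)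
    (E : set T) :
    measurable_fun setT f -> measurable E ->
    (forall A B, measurable A -> measurable B ->
       P (f @^-1` (A `*` B) `&` E) = (m1 A * m2 B * P E)%E) ->
  forall C, measurable C -> P (f @^-1` C `&` E) = ((m1 \x m2) C * P E)%E.
Proof.
move=> mf mE fE C mC.
have mfC B : measurable B -> measurable (f @^-1` B).
  by move=> mB; exact: (measurable_funPTI (mfun_of mf)).
(* when P E is not 0, the law conditioned on E is the product measure *)
have [PE0|PE0] := eqVneq (P E) 0%E.
  rewrite PE0 mule0; apply: (subset_measure0 _ mE) => //.
  exact: measurableI (mfC _ mC) mE.
have PEfin : P E \is a fin_num by exact: fin_num_measure.
have PEV : ((fine (P E))^-1%:E * P E = 1)%E.
  by rewrite -{2}(fineK PEfin) -EFinM mulVf// fine_eq0.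
have r0 : 0 <= (fine (P E))^-1 by rewrite invr_ge0 fine_ge0.
pose m' := mscale (NngNum r0) (pushforward (mrestr P mE) f).
rewrite (@product_measure_unique _ _ _ _ _ m1 m2 (m' mf))//=.
  by rewrite /m' /mscale /= /pushforward /mrestr muleAC PEV mul1e.
move=> A B mA mB; rewrite /m' /mscale /= /pushforward /mrestr.
by rewrite [X in (_ * X)%E](fE A B mA mB) muleCA PEV mule1.
Qed.

Lemma independent_uncorrelated (X Y : T -> R) :
    X \in Lfun P 2%:E -> Y \in Lfun P 2%:E ->
    (forall A B, measurable A -> measurable B ->
       P (X @^-1` A `&` Y @^-1` B) = (P (X @^-1` A) * P (Y @^-1` B))%E) ->
  covariance P X Y = 0%E.
Proof.
move=> X2 Y2 XY.
have PTfin : P setT \is a fin_num by exact: fin_num_measure.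
have X1 := Lfun_subset12 PTfin X2.
have Y1 := Lfun_subset12 PTfin Y2.
have XY1 := Lfun2_mul_Lfun1 X2 Y2.
have mX : measurable_fun setT X by move: X1; rewrite inE => /andP[]; rewrite inE.
have mY : measurable_fun setT Y by move: Y1; rewrite inE => /andP[]; rewrite inE.
pose f w := (X w, Y w).
have mf : measurable_fun setT f by exact: measurable_fun_pair.
pose m1 := distribution P (mfun_of mX).
pose m2 := distribution P (mfun_of mY).
have joint C : measurable C -> pushforward P f C = (m1 \x m2)%E C.
  move=> mC; rewrite /pushforward -[f @^-1` C]setIT.
  rewrite (@joint_law_on _ _ _ _ m1 m2)// ?probability_setT ?mule1// => A B mA mB.
  by rewrite setIT mule1 -XY.
rewrite covarianceE//.
have iXY : P.-integrable setT (EFin \o (fun p : R * R => p.1 * p.2) \o f).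
  exact/Lfun1_integrable.
have mprod : measurable_fun setT (EFin \o (fun p : R * R => p.1 * p.2)).
  apply/measurable_EFinP; apply: measurable_funM.
    exact: measurable_fst.
  exact: measurable_snd.
have eXY : ('E_P[X * Y] = \int[m1 \x m2]_z (z.1 * z.2)%:E)%E.
  rewrite unlock [RHS](eq_measure_integral (pushforward P f)) => [|A mA _].
    by rewrite integral_pushforward.
  exact/esym/joint.
have iprod : (m1 \x m2)%E.-integrable setT (EFin \o (fun p : R * R => p.1 * p.2)).
  have /integrableP[_ iprod] := integrable_pushforward mf mprod iXY measurableT.
  apply/integrableP; split => //.
  rewrite (eq_measure_integral (pushforward P f)) => [|A mA _]; first exact: iprod.
  exact/esym/joint.
rewrite eXY -(integral12_prod_meas1 iprod) /fubini_F /=.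
have eX : ('E_P[X] = \int[m1]_x x%:E)%E.
  rewrite unlock integral_distribution//; exact/Lfun1_integrable.
have eY : ('E_P[Y] = \int[m2]_x x%:E)%E.
  rewrite unlock integral_distribution//; exact/Lfun1_integrable.
have i1 : m1.-integrable setT (EFin : R -> \bar R).
  apply: (integrable_pushforward mX) => //; exact/Lfun1_integrable.
have i2 : m2.-integrable setT (EFin : R -> \bar R).
  apply: (integrable_pushforward mY) => //; exact/Lfun1_integrable.
have fY := expectation_fin_num Y1.
under eq_integral => x _.
  under eq_integral do rewrite EFinM.
  rewrite integralZl// -eY -(fineK fY).
  over.
by rewrite /= integralZr// -eX (fineK fY) subee// fin_numM// expectation_fin_num.
Qed.

End Independence.

(** * Sums and regressions of Gaussian variables *)

Section GaussianLaws.
Context {R : realType}.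
Notation MR := (measurableTypeR R).

Section OneSpace.
Context d (T : measurableType d) (P : probability T R).
Implicit Types (X Y U V : T -> R) (s t l : R).

(** Laws ignore null events; this removes almost surely vanishing summands. *)
Lemma law_eq X Y s (Z : set T) :
    measurable_fun setT X -> measurable_fun setT Y -> measurable Z ->
    P Z = 1%E -> (forall w, Z w -> X w = Y w) -> law P X s -> law P Y s.
Proof.
move=> mX mY mZ PZ XY lX A mA; rewrite -lX//.
have mXA := measurable_funPTI (mfun_of mX) mA.
have mYA := measurable_funPTI (mfun_of mY) mA.
have PZC : P (~` Z) = 0%E by rewrite probability_setC// PZ subee.
have drop D : measurable D -> P D = P (D `&` Z).
  move=> mD; rewrite -[in LHS](setIT D) -(setUv Z) setIUr measureU//.
  - rewrite [X in (_ + X)%E](_ : _ = 0%E) ?adde0//.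
    apply: (subset_measure0 _ (measurableC mZ)) => //.
    by apply: measurableI => //; exact: measurableC.
  - exact: measurableI.
  - by apply: measurableI => //; exact: measurableC.
  - by rewrite setIACA setICr setI0.
rewrite (drop _ mXA) (drop _ mYA); congr (P _).
by apply/seteqP; split => w /= [Aw Zw]; split => //; move: Aw; rewrite XY.
Qed.

Lemma law_scale a X s : measurable_fun setT X -> law P X s ->
  law P (fun w => a * X w) (a * s).
Proof.
move=> mX lX A mA.
have maA : measurable ((fun x : R => a * x) @^-1` A).
  have := measurable_affine a 0 measurableT mA.
  by rewrite setTI; under eq_fun do rewrite addr0.
have := lX _ maA; rewrite /= -[in LHS]/((fun w => a * X w) @^-1` A) => ->.
rewrite /gauss mulf_eq0; have [s0|s0] := eqVneq s 0.
  by rewrite orbT !diracE -[0 \in _ @^-1` _]/(a * 0 \in A) mulr0.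
have [->|a0] /= := eqVneq a 0; last by rewrite normal_prob_scale.
rewrite diracE; have [A0|A0] := pselect (A 0).
  rewrite mem_set// (_ : _ @^-1` A = setT) ?probability_setT//.
  by apply/seteqP; split => x //= _; rewrite mul0r.
rewrite memNset// (_ : _ @^-1` A = set0) ?measure0//.
by apply/seteqP; split => x //=; rewrite mul0r.
Qed.

(** Reversal of a regression.  In V + l U the roles of cause and effect can be
    exchanged: U is the sum of c (V + l U) and of a normal residual that is
    independent of V + l U, with no effect on independence from E. *)
Lemma law_reverse U V s t l (E : set T) (q := Num.sqrt (l ^+ 2 * s ^+ 2 + t ^+ 2))
    (c := l * s ^+ 2 / q ^+ 2) :
    measurable_fun setT U -> measurable_fun setT V -> measurable E ->
    s != 0 -> t != 0 ->
    (forall A B, measurable A -> measurable B ->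
      P (U @^-1` A `&` V @^-1` B `&` E) = (gauss 0 s A * gauss 0 t B * P E)%E) ->
  forall A B, measurable A -> measurable B ->
    P ((fun w => U w - c * (V w + l * U w)) @^-1` A `&`
       (fun w => V w + l * U w) @^-1` B `&` E) =
    (gauss 0 (s * t / q) A * gauss 0 q B * P E)%E.
Proof.
move=> mU mV mE s0 t0 UV A B mA mB.
have q2 : q ^+ 2 = l ^+ 2 * s ^+ 2 + t ^+ 2.
  by rewrite sqr_sqrtr// addr_ge0// ?sqr_ge0// mulr_ge0// sqr_ge0.
have q0 : q != 0.
  rewrite -sqrf_eq0 q2 gt_eqF// ltr_wpDl//; first by rewrite mulr_ge0// sqr_ge0.
  by rewrite exprn_even_gt0.
have st0 : s * t / q != 0 by rewrite !mulf_neq0// invr_eq0.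
rewrite /gauss (negbTE st0) (negbTE q0).
pose f w : MR * MR := (U w, V w).
have mf : measurable_fun setT f by exact: measurable_fun_pair.
have mAB : measurable ((A : set MR) `*` (B : set MR)) by exact: measurableX.
have mS := measurable_funPTI (mfun_of (measurable_shear l c)) mAB.
have := joint_law_on (m1 := normal_prob 0 s) (m2 := normal_prob 0 t) mf mE _ mS.
rewrite /= normal_prob_shear// product_measure1E// => <-//.
move=> A' B' mA' mB'; have := UV _ _ mA' mB'.
by rewrite /gauss (negbTE s0) (negbTE t0).
Qed.

(** For nondegenerate laws this is the second marginal of [law_reverse] with
    l = 1; otherwise one summand vanishes almost surely. *)
Lemma law_add U V s t :
    measurable_fun setT U -> measurable_fun setT V -> law P U s -> law P V t ->
    (forall A B, measurable A -> measurable B ->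
      P (U @^-1` A `&` V @^-1` B) = (P (U @^-1` A) * P (V @^-1` B))%E) ->
  exists r, law P (fun w => U w + V w) r.
Proof.
move=> mU mV lU lV UV.
have mUV : measurable_fun setT (fun w => U w + V w) by exact: measurable_funD.
have zero X : law P X 0 -> P (X @^-1` [set 0]) = 1%E.
  by move/(_ _ (measurable_set1 0)) => ->; rewrite /gauss eqxx diracE mem_set.
have m0 X : measurable_fun setT X -> measurable (X @^-1` [set 0]).
  by move=> mX; exact: (measurable_funPTI (mfun_of mX) (measurable_set1 0)).
have [s0|s0] := eqVneq s 0.
  exists t; rewrite s0 in lU; apply: (law_eq mV mUV (m0 _ mU) (zero _ lU)) => //.
  by move=> w /= ->; rewrite add0r.
have [t0|t0] := eqVneq t 0.
  exists s; rewrite t0 in lV; apply: (law_eq mU mUV (m0 _ mV) (zero _ lV)) => //.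
  by move=> w /= ->; rewrite addr0.
exists (Num.sqrt (1 ^+ 2 * s ^+ 2 + t ^+ 2)) => A mA.
have := @law_reverse U V s t 1 setT mU mV measurableT s0 t0 _ setT A measurableT mA.
rewrite /= preimage_setT setIT setTI probability_setT mule1.
rewrite (_ : gauss _ _ setT = 1%E) ?mul1e; last first.
  by rewrite /gauss; case: ifP => _; [exact: diracT|exact: probability_setT].
under eq_fun do rewrite mul1r addrC; apply => A' B' mA' mB'.
by rewrite setIT mule1 UV// lU// lV.
Qed.

End OneSpace.
End GaussianLaws.

(** * Independent standard normal variables *)

Section IidNormals.
Context {R : realType}.
Notation MR := (measurableTypeR R).

(** Mutual independence tested on the full index set only; choosing the whole
    line for some of the events recovers all subfamilies. *)
Definition indep_family d (T : measurableType d) (P : probability T R) n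
    (X : 'I_n -> T -> R) :=
  forall A : 'I_n -> set R, (forall i, measurable (A i)) ->
    P (\bigcap_i (X i @^-1` A i)) = (\prod_i P (X i @^-1` A i))%E.

Lemma measurable_lincomb d (T : measurableType d) n (X : 'I_n -> T -> R)
    (a : 'I_n -> R) : (forall i, measurable_fun setT (X i)) ->
  measurable_fun setT (fun w => \sum_i a i * X i w).
Proof. by move=> mX; apply: measurable_sum => i; exact: measurable_funM. Qed.

(** Independent standard normal variables are obtained by adding one factor of
    the real line at a time.  That their linear combinations are normal is part
    of the induction because [law_add] applies to the new coordinate and a
    combination of the old ones. *)
Lemma iid_normals n : exists (d : measure_display) (T : measurableType d)
    (P : probability T R) (X : 'I_n -> T -> R),
  [/\ forall i, measurable_fun setT (X i), forall i, law P (X i) 1,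
      indep_family P X &
      forall a : 'I_n -> R, exists r, law P (fun w => \sum_i a i * X i w) r].
Proof.
elim: n => [|n [d [T [P [X [mX lX iX gX]]]]]].
  exists _, MR, (normal_prob 0 1), (fun _ => id); split => //.
  - by case.
  - move=> A mA; rewrite big_ord0 (_ : \bigcap_i _ = setT) ?probability_setT//.
    by apply/seteqP; split => // x _ [].
  - move=> a; exists 0 => A mA; rewrite /gauss eqxx diracE.
    have [A0|A0] := pselect (A 0).
      rewrite mem_set// (_ : _ @^-1` A = setT) ?probability_setT//.
      by apply/seteqP; split => x //= _; rewrite big_ord0.
    rewrite memNset// (_ : _ @^-1` A = set0) ?measure0//.
    by apply/seteqP; split => x //=; rewrite big_ord0.
pose N := @normal_prob R 0 1.
pose X' (i : 'I_n.+1) (p : T * MR) : R :=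
  if unlift ord0 i is Some j then X j p.1 else p.2.
have X'0 p : X' ord0 p = p.2 by rewrite /X' unlift_none.
have X'S j p : X' (lift ord0 j) p = X j p.1 by rewrite /X' liftK.
have mfst : measurable_fun setT (fst : T * MR -> T) by exact: measurable_fst.
have msnd : measurable_fun setT (snd : T * MR -> MR) by exact: measurable_snd.
have PNX A (B : set R) : measurable A -> measurable B ->
    (P \x N)%E (A `*` B) = (P A * N B)%E.
  by move=> mA mB; rewrite product_measure1E.
have PN1 A : measurable A -> (P \x N)%E (fst @^-1` A) = P A.
  move=> mA; rewrite (_ : fst @^-1` A = A `*` setT).
    by rewrite PNX// [N setT]probability_setT mule1.
  by apply/seteqP; split => p //= [].
have PN2 (A : set R) : measurable A -> (P \x N)%E (snd @^-1` A) = N A.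
  move=> mA; rewrite (_ : snd @^-1` A = setT `*` A).
    by rewrite PNX// [P setT]probability_setT mul1e.
  by apply/seteqP; split => p //= [].
have mXA i A : measurable A -> measurable (X i @^-1` A).
  by move=> mA; exact: (measurable_funPTI (mfun_of (mX i)) mA).
have PNS j A : measurable A -> (P \x N)%E (X' (lift ord0 j) @^-1` A) = P (X j @^-1` A).
  move=> mA; rewrite -PN1; last exact: mXA.
  by congr (_ _); apply/seteqP; split => p /=; rewrite X'S.
have PN0 A : measurable A -> (P \x N)%E (X' ord0 @^-1` A) = N A.
  move=> mA; transitivity ((P \x N)%E (snd @^-1` A)); last exact: PN2.
  by congr (_ _); apply/seteqP; split => p /=; rewrite X'0.
exists _, (T * MR)%type, [the probability _ R of (P \x N)%E], X'; split => /=.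
- move=> i; rewrite /X'; case: unliftP => [j _|_] //.
  exact: (measurableT_comp (mX j)).
- move=> i A mA; case: (unliftP ord0 i) => [j|] ->.
    by rewrite [LHS]PNS// lX.
  by rewrite [LHS]PN0// /gauss oner_eq0.
- move=> A mA; rewrite (_ : \bigcap_i _ =
    (\bigcap_i (X i @^-1` A (lift ord0 i))) `*` A ord0).
    rewrite [LHS]PNX//; last by apply: fin_bigcap_measurable => // i _; exact: mXA.
    rewrite iX// [RHS]big_ord_recl muleC; congr (_ * _)%E.
      exact/esym/PN0.
    by apply: eq_bigr => i _; exact/esym/PNS.
  apply/seteqP; split => p /=.
    move=> pA; split; first by move=> i _; have /= := pA (lift ord0 i) I; rewrite X'S.
    by have /= := pA ord0 I; rewrite X'0.
  move=> [pA pA0] i _ /=.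
  by case: (unliftP ord0 i) => [j|] ->; rewrite ?X'0 ?X'S //; exact: pA.
- move=> a; have [r lr] := gX (fun i => a (lift ord0 i)).
  pose U (p : T * MR) := a ord0 * (p.2 : R).
  pose V (p : T * MR) := \sum_j a (lift ord0 j) * X j p.1.
  have mV0 := measurable_lincomb (fun i => a (lift ord0 i)) mX.
  have mU : measurable_fun setT U by exact: measurable_funM.
  have mV : measurable_fun setT V by exact: (measurableT_comp mV0 mfst).
  have [|||r' lr'] := @law_add _ _ _ [the probability _ R of (P \x N)%E] U V
     (a ord0 * 1) r mU mV.
  - apply: law_scale => // A mA.
    by rewrite [LHS]PN2// /gauss oner_eq0.
  - move=> A mA; rewrite -lr// -[RHS]PN1//.
    exact: (measurable_funPTI (mfun_of mV0) mA).
  - move=> A B mA mB; rewrite /=.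
    have mVB := measurable_funPTI (mfun_of mV0) mB.
    have mUA : measurable ((fun x : R => a ord0 * x) @^-1` A).
      by apply: (measurable_funPTI (mfun_of _) mA); exact: measurable_funM.
    rewrite [X in (X * _)%E](PN2 ((fun x : R => a ord0 * x) @^-1` A))//.
    rewrite [X in (_ * X)%E](PN1 ((fun w => \sum_j a (lift ord0 j) * X j w) @^-1` B))//.
    rewrite muleC; transitivity ((P \x N)%E (
        ((fun w => \sum_j a (lift ord0 j) * X j w) @^-1` B) `*`
        ((fun x : R => a ord0 * x) @^-1` A))); last exact: PNX.
    congr (_ _).
    by apply/seteqP; split => p /= [].
  exists r' => A mA.
  transitivity ((P \x N)%E ((fun p => U p + V p) @^-1` A)); last exact: lr'.
  congr (_ _).
  apply/seteqP; split => p /=; rewrite big_ord_recl X'0.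
    by under eq_bigr do rewrite X'S.
  by under [in X in _ -> X]eq_bigr do rewrite X'S.
Qed.

End IidNormals.

(** * Bilinearity of the covariance *)

Section Covariance.
Context d (T : measurableType d) (R : realType) (P : probability T R).
Implicit Types X Y Z : T -> R.

Definition cov X Y : R := fine (covariance P X Y).

Lemma covC X Y : cov X Y = cov Y X.
Proof. by rewrite /cov covarianceC. Qed.

Let PTfin : P setT \is a fin_num. Proof. exact: fin_num_measure. Qed.

Lemma cov_fin_num X Y : X \in Lfun P 2%:E -> Y \in Lfun P 2%:E ->
  covariance P X Y \is a fin_num.
Proof.
move=> X2 Y2; apply: covariance_fin_num; last exact: Lfun2_mul_Lfun1.
  exact: Lfun_subset12 PTfin _ X2.
exact: Lfun_subset12 PTfin _ Y2.
Qed.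

Lemma Lfun2D X Y : X \in Lfun P 2%:E -> Y \in Lfun P 2%:E ->
  (fun w => X w + Y w) \in Lfun P 2%:E.
Proof. by move=> X2 Y2; rewrite rpredD ?lee1n. Qed.

Lemma Lfun2Z a X : X \in Lfun P 2%:E -> (fun w => a * X w) \in Lfun P 2%:E.
Proof.
move=> X2; rewrite (_ : (fun w => _) = a \o* X).
  by apply: Lfun_scale; rewrite ?ler1n.
by apply/funext => w /=; rewrite mulrC.
Qed.

Lemma covDl X Y Z :
    X \in Lfun P 2%:E -> Y \in Lfun P 2%:E -> Z \in Lfun P 2%:E ->
  cov (fun w => X w + Y w) Z = cov X Z + cov Y Z.
Proof.
move=> X2 Y2 Z2; rewrite /cov -fineD ?cov_fin_num//; congr fine.
exact: covarianceDl.
Qed.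

Lemma covZl a X Y : X \in Lfun P 2%:E -> Y \in Lfun P 2%:E ->
  cov (fun w => a * X w) Y = a * cov X Y.
Proof.
move=> X2 Y2; rewrite /cov (_ : (fun w => _) = a \o* X); last first.
  by apply/funext => w /=; rewrite mulrC.
rewrite covarianceZl ?fineM ?cov_fin_num//.
- exact: Lfun_subset12 PTfin _ X2.
- exact: Lfun_subset12 PTfin _ Y2.
- exact: Lfun2_mul_Lfun1.
Qed.

Lemma Lfun2_lincomb (I : Type) (r : seq I) (Q : pred I) (a : I -> R)
    (X : I -> T -> R) : (forall i, X i \in Lfun P 2%:E) ->
  (fun w => \sum_(i <- r | Q i) a i * X i w) \in Lfun P 2%:E.
Proof.
move=> X2; elim: r => [|i r IHr].
  by under eq_fun do rewrite big_nil; exact: Lfun_cst.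
under eq_fun do rewrite big_cons; case: (Q i) => //.
by apply: Lfun2D => //; exact: Lfun2Z.
Qed.

Lemma cov_lincombl (I : Type) (r : seq I) (Q : pred I) (a : I -> R)
    (X : I -> T -> R) Y :
    (forall i, X i \in Lfun P 2%:E) -> Y \in Lfun P 2%:E ->
  cov (fun w => \sum_(i <- r | Q i) a i * X i w) Y =
  \sum_(i <- r | Q i) a i * cov (X i) Y.
Proof.
move=> X2 Y2; elim: r => [|i r IHr].
  under eq_fun do rewrite big_nil; rewrite big_nil.
  by rewrite /cov (covariance_cst_l P 0 Y).
rewrite big_cons; under eq_fun do rewrite big_cons; case: (Q i) => //.
rewrite covDl ?IHr ?covZl//; [exact: Lfun2Z|exact: Lfun2_lincomb].
Qed.

(** The covariance matrix is an invariant of the law, so it can be computed on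
    any probability space that carries a representation. *)
Lemma covmx_pushforward n (mu : probability (n.-tuple R) R)
    (X : {RV P >-> n.-tuple R}) :
    (forall A, measurable A -> mu A = distribution P X A) ->
    (forall i, (fun w => tnth (X w) i) \in Lfun P 2%:E) ->
  forall i j, covmx mu i j = cov (fun w => tnth (X w) i) (fun w => tnth (X w) j).
Proof.
move=> muX X2 i j.
have X1 k := Lfun_subset12 PTfin (X2 k).
have tr (g : n.-tuple R -> R) : measurable_fun setT g ->
    (fun w => g (X w)) \in Lfun P 1 -> ('E_mu[g] = 'E_P[fun w => g (X w)])%E.
  move=> mg g1; rewrite !unlock.
  rewrite (eq_measure_integral (distribution P X)) => [|A mA _]; last exact: muX.
  by rewrite integral_distribution//; [exact/measurable_EFinP|exact/Lfun1_integrable].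
have mt k : measurable_fun setT (fun x : n.-tuple R => tnth x k).
  exact: measurable_tnth.
rewrite mxE /cov !covariance.unlock.
rewrite !(tr (fun x => tnth x _))//; congr fine.
set a := fine _; set b := fine _.
rewrite (tr (((fun x : n.-tuple R => tnth x i) \- cst a) *
  ((fun x : n.-tuple R => tnth x j) \- cst b)))//.
- by apply: measurable_funM; exact: measurable_funB.
- apply: (Lfun2_mul_Lfun1 (f := (fun w => tnth (X w) i) \- cst a)
    (g := (fun w => tnth (X w) j) \- cst b)).
    by rewrite rpredB ?lee1n//= Lfun_cst.
  by rewrite rpredB ?lee1n//= Lfun_cst.
Qed.

End Covariance.

(** * Covariances in a linear structural model *)

Section StructuralModel.
Context {R : realType} (m : nat) (G : digraph m) (f : 'I_m -> nat).
Hypothesis rankG : forall i j, arrow G i j -> (f i < f j)%N.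
Context d (T : measurableType d) (P : probability T R).
Variables (X : {RV P >-> m.-tuple R}) (eps : 'I_m -> {RV P >-> R}).
Variables (Lam : 'M[R]_m) (sig : 'I_m -> R).
Hypothesis eqX : forall i w, tnth (X w) i =
  \sum_(j in Pa G i) Lam i j * tnth (X w) j + eps i w.
Hypothesis law_eps : forall i A, measurable A ->
  distribution P (eps i) A = gauss 0 (sig i) A.
Hypothesis ind_eps : mutually_independent eps.

Let coord i w := tnth (X w) i.

Lemma noise_Lfun2 i : (eps i : T -> R) \in Lfun P 2%:E.
Proof. by apply: (@law_Lfun2 _ _ _ _ _ (sig i)) => // A mA; exact: law_eps. Qed.

(** By induction along a topological order, each coordinate is a finite linear
    combination of noises. *)
Lemma coord_Lfun2 i : coord i \in Lfun P 2%:E.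
Proof.
have [n] := ubnP (f i); elim: n i => // n IHn i /ltnSE fi.
rewrite (_ : coord i =
    (fun w => \sum_(j <- enum (Pa G i) | true) Lam i j * coord j w + eps i w)).
  apply: Lfun2D; last exact: noise_Lfun2.
  have : {subset enum (Pa G i) <= Pa G i} by move=> j; rewrite mem_enum.
  elim: (enum _) => [|j s IHs] sub.
    by under eq_fun do rewrite big_nil; exact: Lfun_cst.
  under eq_fun do rewrite big_cons.
  apply: Lfun2D; last by apply: IHs => k ks; apply: sub; rewrite inE ks orbT.
  apply: Lfun2Z; apply: IHn; apply: leq_trans fi; apply: rankG.
  by have := sub j (mem_head _ _); rewrite inE.
by apply/funext => w; rewrite /coord eqX big_enum.
Qed.

Lemma noise_pair_indep i j (A B : set R) : i != j -> measurable A -> measurable B ->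
  P (eps i @^-1` A `&` eps j @^-1` B) = (P (eps i @^-1` A) * P (eps j @^-1` B))%E.
Proof.
move=> ij mA mB; have ji : (j == i) = false by rewrite eq_sym (negbTE ij).
have := ind_eps [set i; j]%SET (A := fun k => if k == i then A else B).
rewrite big_setU1 ?inE// big_set1 eqxx ji => <- => [|k]; last by case: ifP.
congr (P _); apply/seteqP; split => w /=.
  move=> [Aw Bw] k /=; rewrite !inE => /orP[] /eqP ->.
    by rewrite eqxx.
  by rewrite ji.
move=> h; split.
  by have := h i; rewrite /= !inE eqxx => /(_ isT).
by have := h j; rewrite /= !inE eqxx orbT ji => /(_ isT).
Qed.

Lemma noise_cov0 i j : i != j -> cov P (eps i) (eps j) = 0.
Proof.
move=> ij; rewrite /cov independent_uncorrelated//; try exact: noise_Lfun2.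
by move=> A B; exact: noise_pair_indep.
Qed.

(** A coordinate depends only on the noises at its ancestors and itself, and l is not
    among them when p is another vertex of rank at most that of l. *)
Lemma noise_coord_cov0 l p : p != l -> (f p <= f l)%N ->
  cov P (coord p) (eps l) = 0.
Proof.
have [n] := ubnP (f p); elim: n p => // n IHn p /ltnSE fp pl fpl.
rewrite (_ : coord p =
    (fun w => \sum_(j in Pa G p) Lam p j * coord j w + eps p w)); last first.
  by apply/funext => w; rewrite /coord eqX.
rewrite covDl; last 3 first.
- by apply: Lfun2_lincomb => j; exact: coord_Lfun2.
- exact: noise_Lfun2.
- exact: noise_Lfun2.
rewrite noise_cov0// addr0 cov_lincombl; last 2 first.
- exact: coord_Lfun2.
- exact: noise_Lfun2.
apply: big1 => j; rewrite inE => /rankG jp.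
rewrite IHn ?mulr0//.
- exact: leq_trans fp.
- by apply: contraTneq (leq_trans jp fpl) => ->; rewrite ltnn.
- exact: leq_trans (ltnW jp) fpl.
Qed.

Lemma coord_regression l p : p != l -> (f p <= f l)%N ->
  cov P (coord l) (coord p) =
  \sum_(j in Pa G l) Lam l j * cov P (coord j) (coord p).
Proof.
move=> pl fpl.
rewrite [X in cov P X _](_ : coord l =
    (fun w => \sum_(j in Pa G l) Lam l j * coord j w + eps l w)); last first.
  by apply/funext => w; rewrite /coord eqX.
rewrite covDl; last 3 first.
- by apply: Lfun2_lincomb => j; exact: coord_Lfun2.
- exact: noise_Lfun2.
- exact: coord_Lfun2.
rewrite [cov P (eps l) _]covC noise_coord_cov0// addr0 cov_lincombl//.
- exact: coord_Lfun2.
- exact: coord_Lfun2.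
Qed.

Variable mu : probability (m.-tuple R) R.
Hypothesis muX : forall A, measurable A -> mu A = distribution P X A.

Lemma model_covmx i j : covmx mu i j = cov P (coord i) (coord j).
Proof. by rewrite (covmx_pushforward muX)// => k; exact: coord_Lfun2. Qed.

(** The noise at l is the linear combination of the coordinates with the
    coefficients 1 at l and - Lam l k at the parents k of l; positive
    definiteness makes its variance positive. *)
Lemma noise_nondegenerate l : posdefmx (covmx mu) -> sig l != 0.
Proof.
move=> [_ pd]; apply/negP => /eqP sl0.
pose v : 'cV[R]_m := \col_k ((k == l)%:R - (k \in Pa G l)%:R * Lam l k).
have vl : v l 0 = 1.
  rewrite mxE eqxx inE; have [/rankG|_] := boolP (arrow G l l); rewrite ?ltnn//.
  by rewrite mul0r subr0.
have v0 : v != 0.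
  by apply/eqP => /matrixP/(_ l 0); rewrite vl mxE => /eqP; rewrite oner_eq0.
have vX : (fun w => \sum_k v k 0 * coord k w) = eps l.
  apply/funext => w; under eq_bigr do rewrite mxE mulrBl.
  rewrite sumrB (bigD1 l)//= eqxx mul1r big1 ?addr0; last first.
    by move=> k /negbTE ->; rewrite mul0r.
  apply/eqP; rewrite subr_eq addrC /coord {1}eqX; apply/eqP; congr (_ + _).
  rewrite big_mkcond; apply: eq_bigr => k _.
  by case: (k \in _); rewrite ?mul1r ?mul0r.
have := pd v v0; rewrite (_ : (_ *m v) 0 0 = cov P (eps l) (eps l)).
  rewrite /cov law0_variance ?ltxx// => A mA.
  by have := law_eps l mA; rewrite sl0.
rewrite -vX cov_lincombl; last 2 first.
- exact: coord_Lfun2.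
- by apply: Lfun2_lincomb; exact: coord_Lfun2.
rewrite -mulmxA mxE; apply: eq_bigr => i _; rewrite !mxE; congr (_ * _).
rewrite covC cov_lincombl; last 2 first.
- exact: coord_Lfun2.
- exact: coord_Lfun2.
by apply: eq_bigr => j _; rewrite model_covmx mulrC covC.
Qed.

End StructuralModel.

(** * Topological orders and star models *)

Section DagRank.
Variable m : nat.
Implicit Types (G : digraph m).

(** The number of ancestors is a topological order. *)
Lemma dag_rank G : is_dag G ->
  exists f : 'I_m -> nat, forall i j, arrow G i j -> (f i < f j)%N.
Proof.
move=> dagG; exists (fun j => #|[pred i | connect (arrow G) i j]|) => i j ij.
apply: proper_card; apply/properP; split.
  apply/fintype.subsetP => k; rewrite !inE => ki.
  exact: connect_trans ki (connect1 ij).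
exists j; rewrite !inE ?connect0//; apply/negP => /connectP[p pp lp].
by have /negP := dagG (j :: p) isT; apply; rewrite /= rcons_path pp -lp.
Qed.

Lemma rank_path G (f : 'I_m -> nat) i p :
    (forall i j, arrow G i j -> (f i < f j)%N) ->
  path (arrow G) i p -> (f i + size p <= f (last i p))%N.
Proof.
move=> fG; elim: p i => [|k p IHp] i /=; first by rewrite addn0.
by case/andP => /fG ik /IHp; apply: leq_trans; rewrite addnS -addSn leq_add2r.
Qed.

Lemma rank_dag G (f : 'I_m -> nat) :
  (forall i j, arrow G i j -> (f i < f j)%N) -> is_dag G.
Proof.
move=> fG [//|i p] _; apply/negP => /(rank_path fG).
by rewrite last_rcons size_rcons addnS -ltn_subRL subnn.
Qed.

End DagRank.

Section StarModel.
Context {R : realType}.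

Lemma indep_family_mutual d (T : measurableType d) (P : probability T R) n
    (X : 'I_n -> T -> R) (mX : forall i, measurable_fun setT (X i)) :
  indep_family P X -> mutually_independent (P := P) (fun i => mfun_of (mX i)).
Proof.
move=> iX J A mA.
have := iX (fun i => if i \in J then A i else setT).
rewrite (_ : \bigcap_i _ = \bigcap_(i in [set` J]) (X i @^-1` A i)); last first.
  apply/seteqP; split => w /= h i.
    by move=> iJ; have := h i I; rewrite iJ.
  by move=> _; case: ifP => // /h.
move=> -> => [|i]; last by case: ifP.
rewrite [RHS]big_mkcond; apply: eq_bigr => i _.
by case: ifP => // _; rewrite preimage_setT probability_setT.
Qed.

(** Test distributions for the identification of G: the arrows from K to j carry
    the weight 1 and all others the weight 0.  Row a of c lists the
    coefficients of X_a in the noises, and V their variances. *)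
Lemma star_model m (G : digraph m) (j : 'I_m) (K : {set 'I_m})
    (c := fun a r => (a == r)%:R + ((a == j) && (r \in K))%:R : R) :
    is_dag G -> K \subset Pa G j ->
  exists mu : probability (m.-tuple R) R, Mplus R G mu /\
  exists V : 'I_m -> R, (forall r, 0 < V r) /\
    forall a b, covmx mu a b = \sum_r c a r * c b r * V r.
Proof.
move=> dagG KPa.
have jK k : k \in K -> k != j.
  move=> kK; apply: contraNneq (dagG [:: j] isT) => kj.
  by have := fintype.subsetP KPa _ kK; rewrite inE kj /= andbT.
have [d [T [P [e [me le ie ge]]]]] := @iid_normals R m.
pose Xi a w := \sum_r c a r * e r w.
have mXi a : measurable_fun setT (Xi a) by exact: measurable_lincomb.
pose Xf w := [tuple Xi a w | a < m].
have mXf : measurable_fun setT Xf.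
  apply/measurable_fun_tnthP => a.
  by rewrite (_ : _ \o _ = Xi a)//; apply/funext => w /=; rewrite tnth_mktuple.
pose X : {RV P >-> m.-tuple R} := mfun_of mXf.
pose eps i : {RV P >-> R} := mfun_of (me i).
have ind_eps : mutually_independent eps by exact: indep_family_mutual.
have e2 i : e i \in Lfun P 2%:E by exact: law_Lfun2 (me i) (le i).
have X2 a : (fun w => tnth (X w) a) \in Lfun P 2%:E.
  rewrite (_ : (fun w => _) = Xi a); first exact: Lfun2_lincomb.
  by apply/funext => w; rewrite /= tnth_mktuple.
pose V r := cov P (e r) (e r).
have V0 r : 0 < V r.
  apply: fine_gt0; rewrite (law_variance_gt0 (me r) (oner_neq0 R) (le r)) /=.
  by have := cov_fin_num (e2 r) (e2 r); rewrite fin_numElt => /andP[].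
have cov_e r s : cov P (e r) (e s) = (r == s)%:R * V r.
  have [->|rs] := eqVneq r s; first by rewrite mul1r.
  by rewrite mul0r (@noise_cov0 _ _ _ _ _ eps (fun=> 1)).
pose mu : probability (m.-tuple R) R := distribution P X.
have covE a b : covmx mu a b = \sum_r c a r * c b r * V r.
  rewrite (@covmx_pushforward _ _ _ P _ mu X)//.
  have coordE k : (fun w => tnth (X w) k) = Xi k.
    by apply/funext => w; rewrite /= tnth_mktuple.
  rewrite !coordE cov_lincombl//; last exact: Lfun2_lincomb.
  apply: eq_bigr => r _; rewrite -mulrA; congr (_ * _).
  rewrite covC cov_lincombl// (bigD1 r)//= cov_e eqxx mul1r big1 ?addr0// => s sr.
  by rewrite cov_e (negbTE sr) mul0r mulr0.
exists mu; split; last by exists V.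
split.
- move=> a; have [r lr] := ge (fun k => \sum_i a i * c i k).
  exists 0, r => A mA; rewrite -lr//; congr (P _); apply/seteqP.
  have sumE w : \sum_i a i * tnth (Xf w) i =
      \sum_k (\sum_i a i * c i k) * e k w.
    under [RHS]eq_bigr do rewrite mulr_suml.
    rewrite exchange_big; apply: eq_bigr => i _ /=.
    rewrite tnth_mktuple /Xi mulr_sumr; apply: eq_bigr => k _.
    by rewrite mulrA.
  by split => w /=; rewrite sumE.
- split; first by apply/matrixP => a b; rewrite mxE !covE; apply: eq_bigr => r _;
    rewrite (mulrC (c b r)).
  move=> v v0.
  (* the quadratic form is a weighted sum of squares *)
  have -> : (v^T *m covmx mu *m v) 0 0 =
      \sum_r V r * (\sum_a v a 0 * c a r) ^+ 2.
    rewrite -mulmxA mxE.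
    under eq_bigr => a _ do rewrite !mxE mulr_sumr.
    under [RHS]eq_bigr => r _ do rewrite expr2 big_distrlr /= mulr_sumr.
    rewrite [RHS]exchange_big; apply: eq_bigr => a _ /=.
    under [RHS]eq_bigr => r _ do rewrite mulr_sumr.
    rewrite [RHS]exchange_big; apply: eq_bigr => b _ /=.
    rewrite covE mulr_suml mulr_sumr; apply: eq_bigr => r _.
    by ring.
  rewrite lt_neqAle eq_sym sumr_ge0 ?andbT; last first.
    by move=> r _; rewrite mulr_ge0 ?sqr_ge0// ltW.
  apply: contraNneq v0 => /eqP; rewrite psumr_eq0; last first.
    by move=> r _; rewrite mulr_ge0 ?sqr_ge0// ltW.
  move=> /allP h.
  have {}h r : v r 0 + v j 0 * (r \in K)%:R = 0.
    have := h r (mem_index_enum r); rewrite /= mulf_eq0 gt_eqF//= sqrf_eq0 => /eqP.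
    under eq_bigr => a _ do rewrite mulrDr.
    rewrite big_split /= (bigD1 r)//= eqxx mulr1 big1 ?addr0; last first.
      by move=> a /negbTE ->; rewrite mulr0.
    rewrite (bigD1 j)//= eqxx big1 ?addr0// => a /negbTE ->.
    by rewrite mulr0.
  have vj : v j 0 = 0.
    have := h j; have [/jK|_] := boolP (j \in K); first by rewrite eqxx.
    by rewrite mulr0 addr0.
  apply/eqP/matrixP => r z; rewrite ord1 mxE; have := h r.
  by rewrite vj mul0r addr0.
exists d, T, P, X, eps, (\matrix_(a, k) ((a == j) && (k \in K))%:R), (fun=> 1).
have Xk k w : k != j -> tnth (X w) k = e k w.
  move=> kj; rewrite tnth_mktuple /Xi (bigD1 k)//= /c eqxx (negbTE kj) addr0 mul1r.
  rewrite big1 ?addr0// => r /negbTE rk.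
  by rewrite eq_sym rk addr0 mul0r.
split => //.
- by move=> i k _; rewrite mxE ler0n.
- move=> i w; have [->|ij] := eqVneq i j; last first.
    rewrite Xk// big1 ?add0r// => k _.
    by rewrite mxE (negbTE ij) mul0r.
  rewrite tnth_mktuple /Xi /c.
  under eq_bigr do rewrite eqxx mulrDl.
  rewrite big_split /= addrC; congr (_ + _).
    rewrite [RHS]big_mkcond; apply: eq_bigr => k _; rewrite mxE eqxx /=.
    have [kK|_] := boolP (k \in K); last by rewrite !mul0r; case: ifP.
    by rewrite (fintype.subsetP KPa _ kK) Xk ?jK.
  rewrite (bigD1 j)//= eqxx mul1r big1 ?addr0// => k /negbTE kj.
  by rewrite eq_sym kj mul0r.
Qed.

End StarModel.

(** * Flips of trivially covered arrows *)

Section FlipGraph.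
Variable m : nat.
Implicit Types (G H : digraph m) (i j k a b : 'I_m).

Lemma dag_antisym G a b : is_dag G -> arrow G a b -> arrow G b a = false.
Proof.
by move=> dagG ab; apply/negP => ba; have := dagG [:: a; b] isT; rewrite /= ab ba.
Qed.

Lemma dag_irrefl G a : is_dag G -> arrow G a a = false.
Proof. by move=> dagG; apply/negP => aa; have := dagG [:: a] isT; rewrite /= aa. Qed.

Lemma arrow_flip G i j a b : arrow (flip G i j) a b =
  (a == j) && (b == i) || ~~ ((a == i) && (b == j)) && arrow G a b.
Proof. by rewrite /arrow /flip !inE !xpair_eqE. Qed.

(** In a DAG, being trivially covered means that i is a source and that i is the
    only parent of j. *)
Lemma trivially_coveredP G i j : is_dag G ->
  reflect [/\ i != j, forall k, arrow G k i = false & forall k, arrow G k j = (k == i)]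
    (trivially_covered G i j).
Proof.
move=> dagG; apply: (iffP and3P) => [[ij /eqP Pai /eqP Paj]|[ij ki kj]].
  have PajE k : arrow G k j = (k == i) by have /setP/(_ k) := Paj; rewrite !inE.
  split => // [|k]; first by apply: contraTneq ij => ->; rewrite dag_irrefl.
  apply/negP => aki; have /setP/(_ k) := Pai; rewrite Paj !inE aki /= => /esym/eqP ki.
  by rewrite ki dag_irrefl in aki.
split; first by rewrite kj.
- by apply/eqP/setP => k; rewrite !inE ki kj.
- by apply/eqP/setP => k; rewrite !inE kj.
Qed.

Section Flip.
Variables (G : digraph m) (i j : 'I_m).
Hypotheses (dagG : is_dag G) (covij : trivially_covered G i j).

(** A topological order of the flipped graph starts with j, i and continues with
    the remaining vertices in their old order. *)
Lemma flip_dag : is_dag (flip G i j).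
Proof.
have [ij ki kj] := trivially_coveredP i j dagG covij.
have [f fG] := dag_rank dagG.
pose g k := if k == j then 0%N else if k == i then 1%N else (f k).+2.
apply: (rank_dag (f := g)) => a b; rewrite arrow_flip.
case/orP => [/andP[/eqP -> /eqP ->]|/andP[nab ab]].
  by rewrite /g eqxx (negbTE ij) eqxx.
have bi : b != i by apply: contraTneq ab => ->; rewrite ki.
have bj : b != j.
  by apply: contraNneq nab => bj; move: ab; rewrite bj kj => /eqP ->; rewrite !eqxx.
rewrite /g (negbTE bi) (negbTE bj); case: ifP => // _; case: ifP => // _.
by rewrite !ltnS; exact: fG.
Qed.

Lemma flip_trivially_covered : trivially_covered (flip G i j) j i.
Proof.
have [ij ki kj] := trivially_coveredP i j dagG covij.
apply/(trivially_coveredP _ _ flip_dag); split; first by rewrite eq_sym.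
  move=> k; rewrite arrow_flip (eq_sym j) (negbTE ij) andbF kj eqxx andbT /=.
  by rewrite andNb.
by move=> k; rewrite arrow_flip eqxx ki andbF andbT orbF.
Qed.

Lemma flipK : flip (flip G i j) j i = G.
Proof.
have [ij ki kj] := trivially_coveredP i j dagG covij.
apply/setP => -[a b]; rewrite -!/(arrow _ a b) !arrow_flip.
have ba : (b == i) && arrow G a b = false.
  by apply/negP => /andP[/eqP ->]; rewrite ki.
have ab : (a == i) && (b == j) && ~~ arrow G a b = false.
  by apply/negP => /andP[/andP[/eqP -> /eqP ->]]; rewrite kj eqxx.
by case: (a == j) (b == i) (a == i) (b == j) (arrow G a b) ba ab =>
  [] [] [] [] [].
Qed.

End Flip.
End FlipGraph.

Section FlipModel.
Context {R : realType} (m : nat) (G : digraph m) (i j : 'I_m).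
Hypotheses (dagG : is_dag G) (covij : trivially_covered G i j).

(** The random vector stays the same; only the noises at i and j are replaced, as
    in [law_reverse], and X_i is now regressed on X_j with the nonnegative
    coefficient c. *)
Lemma Mplus_flip_sub (mu : probability (m.-tuple R) R) :
  Mplus R G mu -> Mplus R (flip G i j) mu.
Proof.
have [ij ki kj] := trivially_coveredP i j dagG covij.
have [f fG] := dag_rank dagG.
move=> [gmu pmu [d [T [P [X [eps [Lam [sig [muX Lam0 eqX law_eps ind_eps]]]]]]]]].
split => //.
have s0 l : sig l != 0.
  exact: (noise_nondegenerate fG eqX law_eps muX).
have me k : measurable_fun setT (eps k) by [].
pose l := Lam j i.
pose q := Num.sqrt (l ^+ 2 * sig i ^+ 2 + sig j ^+ 2).
pose c := l * sig i ^+ 2 / q ^+ 2.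
have l0 : 0 <= l by apply: Lam0; rewrite inE kj.
have c0 : 0 <= c by rewrite divr_ge0 ?sqr_ge0// mulr_ge0 ?sqr_ge0.
pose e' k w := if k == i then eps i w - c * (eps j w + l * eps i w)
  else if k == j then eps j w + l * eps i w else eps k w.
have me' k : measurable_fun setT (e' k).
  have mj : measurable_fun setT (fun w => eps j w + l * eps i w).
    by apply: measurable_funD => //; exact: measurable_funM.
  rewrite /e'; case: (k == i); last by case: (k == j).
  by apply: measurable_funB => //; exact: measurable_funM.
pose sig' k := if k == i then sig i * sig j / q else if k == j then q else sig k.
have ji : (j == i) = false by rewrite eq_sym (negbTE ij).
(* E collects the events on the noises at the other vertices *)
have joint A : (forall k, measurable (A k)) ->
    P (\bigcap_k (e' k @^-1` A k)) = (\prod_k gauss 0 (sig' k) (A k))%E.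
  move=> mA.
  pose J := (~: [set i; j])%SET.
  pose E := \bigcap_(k in [set` J]) (eps k @^-1` A k).
  have mE : measurable E.
    apply: fin_bigcap_measurable => // k _; exact: (measurable_funPTI (eps k) (mA k)).
  have rect (B C : set R) : measurable B -> measurable C ->
     P (eps i @^-1` B `&` eps j @^-1` C `&` E) =
     (gauss 0 (sig i) B * gauss 0 (sig j) C * P E)%E.
    move=> mB mC.
    pose A' k := if k == i then B else if k == j then C else A k.
    have mA' k : measurable (A' k) by rewrite /A'; case: ifP => // _; case: ifP.
    have := ind_eps [set: 'I_m]%SET A' mA'.
    rewrite (_ : \bigcap_(_ in _) _ = eps i @^-1` B `&` eps j @^-1` C `&` E).
      move=> ->; rewrite (bigD1 i) ?inE//= (bigD1 j) ?inE 1?eq_sym//=.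
      rewrite muleA; congr (_ * _ * _)%E.
      - by rewrite /A' eqxx -law_eps.
      - by rewrite /A' ji eqxx -law_eps.
      rewrite /E ind_eps//; apply: eq_big => [k|k].
        by rewrite !inE negb_or.
      by case/andP => /andP[_ /negbTE ki'] /negbTE kj'; rewrite /A' ki' kj'.
    apply/seteqP; split => w /= h.
      split; first split.
      - by have := h i; rewrite /A' /= inE eqxx => /(_ isT).
      - by have := h j; rewrite /A' /= inE ji eqxx => /(_ isT).
      move=> k /=; rewrite !inE negb_or => /andP[/negbTE ki' /negbTE kj'].
      by have := h k; rewrite /A' /= inE ki' kj' => /(_ isT).
    move: h => [[hi hj] hE] k _ /=; rewrite /A'.
    have [->//|ki'] := eqVneq k i; have [->//|kj'] := eqVneq k j.
    by apply: hE; rewrite /= !inE negb_or ki' kj'.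
  have := law_reverse l (me i) (me j) mE (s0 i) (s0 j) rect (mA i) (mA j).
  rewrite -/q -/c (_ : _ `&` _ `&` E = \bigcap_k (e' k @^-1` A k)).
    move=> ->; rewrite (bigD1 i)//= (bigD1 j)//=; last by rewrite eq_sym.
    have -> : sig' i = sig i * sig j / q by rewrite /sig' eqxx.
    have -> : sig' j = q by rewrite /sig' ji eqxx.
    rewrite muleA; congr (_ * _)%E.
    rewrite /E ind_eps//; apply: eq_big => [k|k].
      by rewrite !inE negb_or.
    rewrite !inE negb_or => /andP[/negbTE ki' /negbTE kj'].
    by rewrite /sig' ki' kj' -law_eps.
  apply/seteqP; split => w /= h.
    move: h => [[hi hj] hE] k _ /=; rewrite /e'.
    have [->//|ki'] := eqVneq k i; have [->//|kj'] := eqVneq k j.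
    by apply: hE; rewrite /= !inE negb_or ki' kj'.
  split; first split.
  - by have := h i I; rewrite /e' /= eqxx.
  - by have := h j I; rewrite /e' /= ji eqxx.
  move=> k /=; rewrite !inE negb_or => /andP[/negbTE ki' /negbTE kj'].
  by have := h k I; rewrite /e' /= ki' kj'.
have gT s : gauss 0 s setT = 1%E :> \bar R.
  by rewrite /gauss; case: ifP => _; [exact: diracT|exact: probability_setT].
have law_e' k A : measurable A -> P (e' k @^-1` A) = gauss 0 (sig' k) A.
  move=> mA; have := joint (fun a => if a == k then A else setT).
  rewrite (_ : \bigcap_a _ = e' k @^-1` A).
    move=> -> => [|a]; last by case: ifP.
    rewrite (bigD1 k)//= eqxx big1 ?mule1// => a /negbTE ->; exact: gT.
  apply/seteqP; split => w /= => [/(_ k I)|h a _ /=]; first by rewrite /= eqxx.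
  by have [->|] := eqVneq a k.
have mut : mutually_independent (P := P) (fun k => mfun_of (me' k)).
  apply: indep_family_mutual => A mA; rewrite joint//.
  by apply: eq_bigr => k _; rewrite law_e'.
exists d, T, P, X, (fun k => mfun_of (me' k)),
  (\matrix_(a, b) if a == i then c else Lam a b), sig'; split => //.
- move=> a b; rewrite mxE inE arrow_flip; case: ifP => // ai.
  by rewrite andbF /= => /andP[_ ab]; apply: Lam0; rewrite inE.
- have Xi w : tnth (X w) i = eps i w.
    by rewrite eqX big1 ?add0r// => k; rewrite inE ki.
  have Xj w : tnth (X w) j = eps j w + l * eps i w.
    rewrite eqX (big_pred1 i); first by rewrite Xi addrC.
    by move=> k; rewrite !inE kj.
  move=> k w; rewrite /= /e'; have [->|ki'] := eqVneq k i.
    rewrite (big_pred1 j); last first.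
      by move=> a; rewrite !inE arrow_flip eqxx ki andbF orbF andbT.
    by rewrite mxE eqxx Xj Xi addrC subrK.
  have [->|kj'] := eqVneq k j.
    rewrite big1 ?add0r// => a; rewrite inE arrow_flip ji andbF eqxx andbT kj /=.
    by rewrite andNb.
  rewrite eqX; congr (_ + _); apply: eq_big => a.
    by rewrite !inE arrow_flip (negbTE ki') (negbTE kj') !andbF.
  by rewrite mxE (negbTE ki').
Qed.

End FlipModel.

(** * Identification of the graph up to flips *)

Section Identification.
Context {R : realType} (m : nat).
Implicit Types (G H : digraph m) (i j k : 'I_m).

(** The trace that H leaves in the covariance matrix: this is all that is used
    about membership in the model of H. *)
Lemma Mplus_regression H (f : 'I_m -> nat) (mu : probability (m.-tuple R) R) :
    (forall i j, arrow H i j -> (f i < f j)%N) -> Mplus R H mu ->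
  exists Lam : 'M[R]_m, (forall l q, arrow H q l -> 0 <= Lam l q) /\
    forall l p, p != l -> (f p <= f l)%N ->
      covmx mu l p = \sum_(q | arrow H q l) Lam l q * covmx mu q p.
Proof.
move=> fH [_ _ [d [T [P [X [eps [Lam [sig [muX Lam0 eqX law_eps ind_eps]]]]]]]]].
exists Lam; split => [l q ql|l p pl fpl]; first by apply: Lam0; rewrite inE.
have covE := model_covmx fH eqX law_eps muX.
rewrite covE (coord_regression fH eqX law_eps ind_eps)//.
by apply: eq_big => q; rewrite ?inE// covE.
Qed.

(** In the star model with the single arrow [i -> j], X_i and X_j are correlated
    and all other pairs are uncorrelated.  If the later of i and j in H were not
    a child of the other one, the regression formula would give covariance 0. *)
Lemma Mplus_adjacent G H i j : is_dag G -> is_dag H ->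
    Mplus R G `<=` Mplus R H -> arrow G i j ->
  arrow H i j \/ arrow H j i.
Proof.
move=> dagG dagH GH ij.
have [f fH] := dag_rank dagH.
have ji : j != i by apply: contraTneq ij => ->; rewrite dag_irrefl.
have iPa : [set i]%SET \subset Pa G j by rewrite finset.sub1set inE.
have [mu [/GH muH [V [V0 covE]]]] := @star_model R m G j [set i]%SET dagG iPa.
have [Lam [_ reg]] := Mplus_regression fH muH.
have cov_i q : covmx mu q i = ((q == i)%:R + (q == j)%:R) * V i.
  rewrite covE (bigD1 i)//= big1 ?addr0; last first.
    move=> r ri; rewrite (eq_sym i) (negbTE ri) (eq_sym i) (negbTE ji) /=.
    by rewrite addr0 mulr0 mul0r.
  by rewrite !inE !eqxx (eq_sym i) (negbTE ji) !andbT addr0 mulr1.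
have cov_j q : q != j -> covmx mu q j = (q == i)%:R * V i.
  move=> qj; rewrite covE (bigD1 q)//= big1 ?addr0; last first.
    by move=> r rq; rewrite (eq_sym q) (negbTE rq) (negbTE qj) addr0 !mul0r.
  rewrite eqxx (negbTE qj) addr0 mul1r (eq_sym j) (negbTE qj) eqxx inE /= add0r.
  by have [->|] := eqVneq q i; rewrite ?mul0r.
have Vi := gt_eqF (V0 i).
case: (leqP (f i) (f j)) => fij.
- left; apply: contraFT Vi => nij.
  have := reg j i; rewrite eq_sym => /(_ ji fij).
  rewrite cov_i eqxx (negbTE ji) add0r mul1r => ->.
  rewrite big1// => q qj; rewrite cov_i.
  have -> : (q == i) = false by apply: contraNF nij => /eqP <-.
  have -> : (q == j) = false by apply: contraTF qj => /eqP ->; rewrite dag_irrefl.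
  by rewrite addr0 mul0r mulr0.
- right; apply: contraFT Vi => nji.
  have := reg i j ji (ltnW fij).
  rewrite cov_j 1?eq_sym// eqxx mul1r => ->.
  rewrite big1// => q qi.
  have qj : q != j by apply: contraNneq nji => <-.
  rewrite cov_j//.
  have -> : (q == i) = false by apply: contraTF qi => /eqP ->; rewrite dag_irrefl.
  by rewrite mul0r mulr0.
Qed.

(** Otherwise take the star model with centre j and chosen parents i and k.  As
    [j -> i] in H, the last of i, j, k in H is i or k; call it l and the other
    one z.  The covariance of X_l and X_z is 0 and is a sum of nonnegative terms
    over the parents of l in H, so every parent correlated with X_z, in
    particular j and z, has weight 0.  No other parent is correlated with X_j, so
    the covariance of X_l and X_j would vanish, but it is positive. *)
Lemma Mplus_reversed_parent G H i j k : is_dag G -> is_dag H ->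
    Mplus R G `<=` Mplus R H -> arrow G i j -> arrow H j i -> arrow G k j ->
  k = i.
Proof.
move=> dagG dagH GH ij ji kj; apply/eqP; case: (boolP (k == i)) => // ki; exfalso.
have [f fH] := dag_rank dagH.
have Gneq a : arrow G a j -> a != j.
  by move=> aj; apply: contraTneq aj => ->; rewrite dag_irrefl.
have ij' := Gneq _ ij; have kj' := Gneq _ kj.
have KPa : [set i; k]%SET \subset Pa G j.
  by apply/fintype.subsetP => a; rewrite !inE => /orP[] /eqP ->.
have [mu [/GH muH [V [V0 covE]]]] := @star_model R m G j [set i; k]%SET dagG KPa.
have [Lam [Lam0 reg]] := Mplus_regression fH muH.
have [l [z [lz Klz flz]]] : exists l z, [/\ z != l,
    [set i; k]%SET = [set l; z]%SET & ((f z <= f l) && (f j < f l))%N].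
  case: (leqP (f k) (f i)) => fki.
    by exists i, k; rewrite ki fki fH.
  exists k, i; rewrite eq_sym ki finset.setUC (ltnW fki).
  by rewrite (ltn_trans (fH _ _ ji) fki).
have [fz fj] := andP flz.
have lj : l != j by apply: contraTneq fj => ->; rewrite ltnn.
have zj : z != j.
  have : z \in [set l; z]%SET by rewrite !inE eqxx orbT.
  by rewrite -Klz !inE => /orP[] /eqP ->.
rewrite Klz in covE.
have cov_z q : covmx mu q z = ((q == z)%:R + (q == j)%:R) * V z.
  rewrite covE (bigD1 z)//= big1 ?addr0; last first.
    by move=> r /negbTE rz; rewrite (eq_sym z) rz (negbTE zj) addr0 mulr0 mul0r.
  by rewrite !inE !eqxx (negbTE zj) orbT !andbT addr0 mulr1.
have cov_j q : q != j ->
    covmx mu q j = ((q == l)%:R + (q == z)%:R) * V q.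
  move=> qj; rewrite covE (bigD1 q)//= big1 ?addr0; last first.
    by move=> r rq; rewrite (eq_sym q) (negbTE rq) (negbTE qj) addr0 !mul0r.
  rewrite eqxx (negbTE qj) addr0 mul1r (eq_sym j) (negbTE qj) eqxx !inE /= add0r.
  have [->|ql] := eqVneq q l; last by rewrite add0r.
  by rewrite eq_sym (negbTE lz) addr0.
have ql q : arrow H q l -> q != l.
  by move=> aql; apply: contraTneq aql => ->; rewrite dag_irrefl.
have term0 q : arrow H q l -> Lam l q * covmx mu q z = 0.
  have := reg l z lz fz.
  rewrite cov_z (eq_sym l) (negbTE lz) (negbTE lj) addr0 mul0r => /esym/eqP.
  rewrite psumr_eq0 => [/allP h qlH|r rl]; last first.
    by rewrite mulr_ge0 ?Lam0// cov_z mulr_ge0 ?addr_ge0 ?ler0n// ltW.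
  by have /implyP/(_ qlH)/eqP := h q (mem_index_enum q).
have := reg l j; rewrite eq_sym => /(_ lj (ltnW fj)).
rewrite cov_j// eqxx (eq_sym l) (negbTE lz) addr0 mul1r big1 => [Vl|q aql].
  by have := V0 l; rewrite Vl ltxx.
have := term0 q aql; rewrite cov_z => /eqP; rewrite mulf_eq0 mulf_eq0 (gt_eqF (V0 z)) orbF.
have [qj|qj] := eqVneq q j.
  rewrite qj (eq_sym j) (negbTE zj) add0r oner_eq0 orbF => /eqP ->.
  by rewrite mul0r.
rewrite addr0 cov_j// (negbTE (ql _ aql)) add0r.
case: (q == z) => /=; last by rewrite mul0r mulr0.
by rewrite oner_eq0 orbF => /eqP ->; rewrite mul0r.
Qed.

Lemma Mplus_flip G i j : is_dag G -> trivially_covered G i j ->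
  Mplus R (flip G i j) = Mplus R G.
Proof.
move=> dagG cov_ij; apply/seteqP; split => mu; last exact: Mplus_flip_sub.
move/(Mplus_flip_sub (flip_dag dagG cov_ij) (flip_trivially_covered dagG cov_ij)).
by rewrite flipK.
Qed.

Lemma Mplus_flip_reachable G H : is_dag G -> flip_reachable G H ->
  Mplus R G = Mplus R H.
Proof.
move=> dagG /connectP[p]; elim: p G dagG => [G _ _ ->//|G' p IHp G dagG] /=.
case/andP => /existsP[i /existsP[j /andP[cov_ij /eqP ->]]] pp Hp.
by rewrite -(IHp _ (flip_dag dagG cov_ij) pp Hp) Mplus_flip.
Qed.

(** Induction on the number of arrows of G outside H.  Such arrows are exactly
    those that H reverses, and the one with the earliest source in G is trivially
    covered. *)
Lemma flip_reachable_Mplus G H : is_dag G -> is_dag H ->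
  Mplus R G = Mplus R H -> flip_reachable G H.
Proof.
move=> dagG dagH; have [n] := ubnP #|G :\: H|%SET.
elim: n G dagG => // n IHn G dagG /ltnSE GHn eqGH.
have subGH : Mplus R G `<=` Mplus R H by rewrite eqGH.
have subHG : Mplus R H `<=` Mplus R G by rewrite eqGH.
have [GH0|[[a b] abGH]] := set_0Vmem (G :\: H)%SET.
  have GsubH a b : arrow G a b -> arrow H a b.
    move=> ab; apply: contraT => nab.
    have : (a, b) \in (G :\: H)%SET by rewrite inE; apply/andP.
    by rewrite GH0 inE.
  rewrite (_ : H = G); first exact: connect0.
  apply/setP => -[a b]; rewrite -!/(arrow _ a b); apply/idP/idP; last exact: GsubH.
  move=> ab; have [//|/GsubH ba] := Mplus_adjacent dagH dagG subHG ab.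
  by rewrite (dag_antisym dagH ab) in ba.
have [f fG] := dag_rank dagG.
have [[i j] /=] := @arg_minnP _ (a, b) [in (G :\: H)%SET] (fun e => f e.1) abGH.
rewrite inE => /andP[nijH ijG] minf.
have jiH : arrow H j i.
  have [ijH|//] := Mplus_adjacent dagG dagH subGH ijG.
  by case/negP: nijH.
have kj k : arrow G k j = (k == i).
  apply/idP/eqP => [|->//]; exact: Mplus_reversed_parent subGH ijG jiH.
have ki k : arrow G k i = false.
  apply/negP => kiG; have [kiH|kiH] := boolP (arrow H k i).
    have kjE := Mplus_reversed_parent dagH dagG subHG jiH ijG kiH.
    by rewrite kjE (dag_antisym dagG ijG) in kiG.
  have := minf (k, i); rewrite inE /= => /(_ _); rewrite leqNgt fG// => h.
  by have : false by apply: h; apply/andP.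
have covij : trivially_covered G i j.
  apply/trivially_coveredP => //; split => //.
  by apply: contraTneq ijG => ->; rewrite -/(arrow G j j) dag_irrefl.
apply: (@connect_trans _ _ (flip G i j)).
  by apply: connect1; apply/existsP; exists i; apply/existsP; exists j; rewrite covij /=.
apply: IHn; first exact: flip_dag.
  apply: leq_trans GHn; apply: proper_card; apply/properP; split.
    apply/fintype.subsetP => -[x y]; rewrite !inE -!/(arrow _ x y) => /andP[nxyH].
    rewrite nxyH => /orP[/eqP[xj yi]|/andP[]//].
    by case/negP: nxyH; rewrite xj yi.
  exists (i, j); first by rewrite inE nijH.
  rewrite !inE eqxx /= orbF negb_and; apply/orP; right.
  by apply/eqP => -[]; move/trivially_coveredP: covij => /(_ dagG)[/eqP ij _ _] /ij.
by rewrite Mplus_flip.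
Qed.

End Identification.

Theorem theorem4p3 (R : realType) (m : nat) (G H : digraph m)
    (dagG : is_dag G) (dagH : is_dag H) :
  Mplus R G = Mplus R H <-> flip_reachable G H.
Proof.
split; first exact: flip_reachable_Mplus.
exact: Mplus_flip_reachable.
Qed.
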